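(* Assume that $\gamma<1$ and $\delta<1/2$. Then, for any $\eta>0$, $$|S_n|=o\big(\sqrt{n(\log n)^{1+\eta}}\big)\quad\text{a.s. as } n\to\infty.$$
   Context: Setting. Let $d\ge 1$ and let $\mathcal{S}_{\mathfrak{e}},\mathcal{S}_{\mathfrak{o}},V_{\mathfrak{e}},V_{\mathfrak{o}}\subset\mathbf{R}^d$, with $V_{\mathfrak{o}},V_{\mathfrak{e}}$ finite, satisfy: (1) $x+v\in\mathcal{S}_{\mathfrak{o}}$ for $x\in\mathcal{S}_{\mathfrak{e}}$, $v\in V_{\mathfrak{o}}$; (2) $x+v\in\mathcal{S}_{\mathfrak{e}}$ for $x\in\mathcal{S}_{\mathfrak{o}}$, $v\in V_{\mathfrak{e}}$; (3) $V_{\mathfrak{o}}=-V_{\mathfrak{e}}$; (4) $0\in\mathcal{S}_{\mathfrak{e}}$; (5) $V_{\mathfrak{o}}\cap V_{\mathfrak{e}}=\emptyset$. Put $V=V_{\mathfrak{o}}\cup V_{\mathfrak{e}}$, let $m$ be the common cardinality of $V_{\mathfrak{o}}$ and $V_{\mathfrak{e}}$, and assume $m\ge2$. Fix $p,q\in[0,1]$ and set $\alpha=\frac{mp-1}{m-1}$, $\beta=\frac{mq-1}{m-1}$, $\gamma=\frac12(\alpha+\beta)$, $\delta=\frac12(\alpha-\beta)$. For each $k\ge2$ and $v\in V$ let $G_k(v)$ be a random variable with values in $V_{\mathfrak{o}}$ if $k$ is odd and in $V_{\mathfrak{e}}$ if $k$ is even, with the following law. Let $W$ denote $V_{\mathfrak{o}}$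 if $k$ is odd and $V_{\mathfrak{e}}$ if $k$ is even, and let $w\in W$. If $v\in W$, then $\boldsymbol{P}(G_k(v)=w)=p$ for $w=v$ and $\frac{1-p}{m-1}$ for $w\ne v$. If $v\in V\setminus W$ (so $-v\in W$), then $\boldsymbol{P}(G_k(v)=w)=q$ for $w=-v$ and $\frac{1-q}{m-1}$ for $w\neq -v$. Let $X_1$ be uniform on $V_{\mathfrak{o}}$ and, for $n\ge1$, let $\mathcal{U}_n$ be uniform on $\{1,\dots,n\}$. The $\sigma$-fields $\sigma(X_1),\ \sigma(\mathcal{U}_1,\{G_2(v)\}_{v\in V}),\ \sigma(\mathcal{U}_2,\{G_3(v)\}_{v\in V}),\dots$ are independent, and for each $n\ge1$, $\mathcal{U}_n$ is independent of $\{G_{n+1}(v)\}_{v\in V}$. Define, for $n\geq 1$, $X_{n+1}=G_{n+1}(X_{\mathcal{U}_n})$; and $S_0=0$, $S_{n+1}=S_n+X_{n+1}$ for $n\ge0$ (the elephant random walk). $a_n=o(b_n)$ means $a_n/b_n\to0$; $|\cdot|$ is the Euclidean norm. *)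

(* Defs.v *)
From mathcomp Require Import all_boot all_order all_algebra finmap.
From mathcomp Require Import all_classical all_reals all_analysis.
Set Implicit Arguments.
Unset Strict Implicit.
Unset Printing Implicit Defensive.
Import Order.TTheory GRing.Theory Num.Theory.
Import numFieldNormedType.Exports.
Local Open Scope classical_set_scope.
Local Open Scope ring_scope.

(* R^d with its Borel sigma-field. *)
Notation borel_rV R d := (g_sigma_algebraType (@open 'rV[R]_d)).

(* The library norm on matrices is the sup norm, hence this definition. *)
Definition euclid_norm (R : realType) (d : nat) (x : 'rV[R]_d) : R :=
  Num.sqrt (\sum_(i < d) x 0 i ^+ 2).

Record bipartite_steps (R : realType) (d : nat)
    (Se So : set 'rV[R]_d) (Ve Vo : {fset 'rV[R]_d}) : Prop := {
  step_even : forall x v, Se x -> v \in Vo -> So (x + v) ;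
  step_odd : forall x v, So x -> v \in Ve -> Se (x + v) ;
  step_opp : Vo = [fset - v | v in Ve]%fset ;
  step_origin : Se 0 ;
  step_disjoint : (Vo `&` Ve)%fset = fset0
}.

(* Set of possible values of the k-th step. *)
Definition steps (R : realType) (d : nat) (Ve Vo : {fset 'rV[R]_d}) (k : nat)
    : {fset 'rV[R]_d} :=
  if odd k then Vo else Ve.

(* P(G_k(v) = w), for w in W := steps Ve Vo k and v in Vo `|` Ve.  When v is
   not in W, - v is. *)
Definition turn_prob (R : realType) (d : nat) (p q : R)
    (W : {fset 'rV[R]_d}) (v w : 'rV[R]_d) : R :=
  let m : R := #|` W|%:R in
  if v \in W then (if w == v then p else (1 - p) / (m - 1))
  else (if w == - v then q else (1 - q) / (m - 1)).

(* Mutual independence of a family of sigma-fields on the probability space: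
   the product rule over every finite subfamily. *)
Definition independent_fields (R : realType) (dO : measure_display)
    (Omega : measurableType dO) (P : probability Omega R) (I : choiceType)
    (F : I -> set (set Omega)) : Prop :=
  forall (J : {fset I}) (A : I -> set Omega),
    (forall j, j \in J -> F j (A j)) ->
    P (\bigcap_(j in [set` J]) A j) = (\prod_(j <- J) P (A j))%E.

Section model.
Context (R : realType) (d : nat) (Ve Vo : {fset 'rV[R]_d}).
Context (dO : measure_display) (Omega : measurableType dO).
Context (P : probability Omega R).
Context (p q : R).
Context (X1 : {RV P >-> borel_rV R d}) (U : nat -> {RV P >-> nat}).
Context (G : nat -> 'rV[R]_d -> {RV P >-> borel_rV R d}).

(* sigma({G_k(v)}_{v in V}) *)
Definition turns_field (k : nat) : set (set Omega) :=
  <<s \bigcup_(v in [set` (Vo `|` Ve)%fset])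
        g_sigma_algebra_preimage (G k v) >>.

(* The fields sigma(X_1) (n = 0) and sigma(U_n, {G_{n+1}(v)}_{v in V})
   (n >= 1). *)
Definition erw_field (n : nat) : set (set Omega) :=
  if n == 0%N then g_sigma_algebra_preimage X1
  else <<s g_sigma_algebra_preimage (U n) `|` turns_field n.+1 >>.

(* The values of U 0, of G 0 and G 1, and of G k v for v outside Vo `|` Ve are
   left unconstrained; they play no role. *)
Record erw_model : Prop := {
  first_val : forall omega, X1 omega \in Vo ;
  first_law : forall w, w \in Vo ->
    P (X1 @^-1` [set w]) = (#|` Vo|%:R^-1)%:E ;
  time_val : forall n, (1 <= n)%N -> forall omega, (1 <= U n omega <= n)%N ;
  time_law : forall n i, (1 <= n)%N -> (1 <= i <= n)%N ->
    P (U n @^-1` [set i]) = (n%:R^-1)%:E ;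
  turn_val : forall k v, (2 <= k)%N -> v \in (Vo `|` Ve)%fset ->
    forall omega, G k v omega \in steps Ve Vo k ;
  turn_law : forall k v w, (2 <= k)%N -> v \in (Vo `|` Ve)%fset ->
    w \in steps Ve Vo k ->
    P (G k v @^-1` [set w]) = (turn_prob p q (steps Ve Vo k) v w)%:E ;
  erw_indep : independent_fields P erw_field ;
  time_turn_indep : forall n, (1 <= n)%N ->
    forall A B, g_sigma_algebra_preimage (U n) A -> turns_field n.+1 B ->
    P (A `&` B) = (P A * P B)%E
}.

Record erw_walk (X S : nat -> Omega -> 'rV[R]_d) : Prop := {
  step1 : forall omega, X 1%N omega = X1 omega ;
  stepS : forall n omega, (1 <= n)%N ->
    X n.+1 omega = G n.+1 (X (U n omega) omega) omega ;
  walk0 : forall omega, S 0%N omega = 0 ;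
  walkS : forall n omega, S n.+1 omega = S n omega + X n.+1 omega
}.

End model.

Definition erw_alpha (R : realType) (m : nat) (p : R) : R :=
  (m%:R * p - 1) / (m%:R - 1).
Definition erw_beta (R : realType) (m : nat) (q : R) : R :=
  (m%:R * q - 1) / (m%:R - 1).
Definition erw_gamma (R : realType) (m : nat) (p q : R) : R :=
  2^-1 * (erw_alpha m p + erw_beta m q).
Definition erw_delta (R : realType) (m : nat) (p q : R) : R :=
  2^-1 * (erw_alpha m p - erw_beta m q).

(* a_n = o(b_n).  A vanishing b_n for finitely many n is harmless. *)
Definition little_o (R : realType) (a b : nat -> R) : Prop :=
  (fun n => a n / b n) @ \oo --> (0 : R).

(* Main.v *)
Require Import Defs.
From mathcomp Require Import all_boot all_order all_algebra finmap.
From mathcomp Require Import all_classical all_reals all_analysis.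
From mathcomp Require Import ring lra zify.
Set Implicit Arguments.
Unset Strict Implicit.
Unset Printing Implicit Defensive.
Import Order.TTheory GRing.Theory Num.Theory.
Import numFieldNormedType.Exports.
Local Open Scope classical_set_scope.
Local Open Scope ring_scope.

(** Fix a coordinate and let e_k = (-1)^(k+1).  Subtracting from the k-th step
    its stationary mean, which is e_k times the barycentre of [Vo], gives
    bounded centred steps Y_k.  Averaging the law of a turn over the uniformly
    remembered date shows that, with C_n = Y_1 + ... + Y_n and
    T_n = e_1 Y_1 + ... + e_n Y_n,
      E(Y_(n+1) | past) = delta * C_n / n + gamma * e_(n+1) * T_n / n.
    The second term is only bounded, but its sign alternates while T_n / n varies
    by O(1/n) at each date.  Summation by parts therefore absorbs it: the
    corrected position Z_n = C_n - (gamma / 2) * e_n * T_n / n stays at bounded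
    distance from the walk, and
      Z_(n+1) = (1 + delta / n) * Z_n + O(1/n) + bounded martingale difference.

    By Hoeffding's argument ([hoeffding_mgf], [mgf_step]) the moment generating
    function of Z_(n+1) at l is controlled by that of Z_n at
    l * (1 + delta / n).  Since delta < 1/2, this recursion preserves a bound
    exp(A l^2 n + B) ([gaussian_mgf]): the walk has Gaussian tails on the
    diffusive scale.  Chernoff's inequality makes the probability that |Z_n|
    exceeds sqrt(8 A n log n) an O(n^-2), and the Borel-Cantelli lemma yields
    |S_n| = O(sqrt(n log n)) almost surely ([erw_coord_bound]), which is stronger
    than the claim.  As the tails are summable over all n, no maximal inequality
    enters.

    Conditional expectations are finite sums here.  The first n steps take
    finitely many values, the histories; by independence the probability of a
    history is the product of the one-step kernels along it ([prob_history]),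
    and all the estimates above concern this finite law. *)

(** * Exponential moments *)

Section exponential_moments.
Context (R : realType).

(** The linear term on the right vanishes after averaging a centred variable, so
    that the second-order behaviour of the exponential is all that remains. *)
Lemma expR_le_add_expR_sqr (y : R) : expR y <= y + expR (2 * y ^+ 2).
Proof.
have E := expR_ge1Dx (2 * y ^+ 2).
(* the cut at [1 / 2] fits both cases: [1 / (1 - y) <= 1 + y + 2 * y ^+ 2] below
   it and [y <= 2 * y ^+ 2] above it *)
have [y_lt|y_ge] := ltP y (2^-1).
- have pos : 0 < 1 - y by lra.
  have inv : expR y <= (1 - y)^-1.
    have := expR_ge1Dx (- y); rewrite expRN => h.
    by rewrite -[expR y]invrK lef_pV2 ?posrE ?invr_gt0 ?expR_gt0.
  apply: (le_trans inv); rewrite -div1r ler_pdivrMr //.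
  by have := sqr_ge0 y; nra.
- have : expR y <= expR (2 * y ^+ 2) by rewrite ler_expR; nra.
  by lra.
Qed.

(** The values [c i] lie within [2 * K] of their average, and the preceding bound
    doubles the square of that distance: hence the factor [8 * K ^+ 2]. *)
Lemma hoeffding_mgf (I : eqType) (r : seq I) (w c : I -> R) (K l : R) :
    (forall i, i \in r -> 0 <= w i) -> \sum_(i <- r) w i = 1 ->
    (forall i, i \in r -> `|c i| <= K) ->
  \sum_(i <- r) w i * expR (l * c i) <=
    expR (l * (\sum_(i <- r) w i * c i) + 8 * K ^+ 2 * l ^+ 2).
Proof.
move=> w0 w1 cK; set mu := \sum_(i <- r) _ * c _.
have mK : `|mu| <= K.
  apply: (le_trans (ler_norm_sum _ _ _)).
  rewrite -[K]mul1r -w1 mulr_suml !big_seq ler_sum // => i ir.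
  by rewrite normrM ger0_norm ?w0 // ler_wpM2l ?w0 ?cK.
have centred : \sum_(i <- r) w i * (c i - mu) = 0.
  under eq_bigr do rewrite mulrBr.
  by rewrite big_split /= sumrN -mulr_suml w1 mul1r subrr.
have dev i : i \in r -> w i * expR (l * c i) <=
    expR (l * mu) * (l * (w i * (c i - mu)) + w i * expR (8 * K ^+ 2 * l ^+ 2)).
  move=> ir; have -> : l * c i = l * mu + l * (c i - mu) by ring.
  rewrite expRD mulrCA ler_pM2l ?expR_gt0 //.
  rewrite [l * (w i * _)]mulrCA -mulrDr ler_wpM2l ?w0 //.
  apply: (le_trans (expR_le_add_expR_sqr _)); rewrite lerD2l ler_expR.
  have -> : 2 * (l * (c i - mu)) ^+ 2 = l ^+ 2 * (2 * (c i - mu) ^+ 2) by ring.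
  have -> : 8 * K ^+ 2 * l ^+ 2 = l ^+ 2 * (2 * (2 * K) ^+ 2) by ring.
  rewrite ler_wpM2l ?sqr_ge0 // ler_wpM2l // -real_normK ?num_real //.
  have K0 : 0 <= 2 * K by move: (normr_ge0 mu) mK; lra.
  rewrite ler_sqr ?nnegrE //.
  by apply: (le_trans (ler_normB _ _)); rewrite mulr2n mulrDl mul1r lerD ?cK.
apply: (@le_trans _ _ (\sum_(i <- r) expR (l * mu) *
   (l * (w i * (c i - mu)) + w i * expR (8 * K ^+ 2 * l ^+ 2)))).
  rewrite big_seq [leRHS]big_seq; apply: ler_sum => i ir; exact: dev.
rewrite -mulr_sumr big_split /= -mulr_sumr centred mulr0 add0r -mulr_suml w1 mul1r.
by rewrite expRD.
Qed.

(** In the recursion the argument [l] grows by the factor [1 + delta / n], so a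
    bound [A * n * l ^+ 2] becomes about [A * (n + 2 * delta) * l ^+ 2]; since
    [2 * delta < 1], replacing [n] by [n + 1] leaves room for the increment
    [C * l ^+ 2] once [A] is large.  The term linear in [`|l|] is split between
    [l ^+ 2] and [n ^- 2], and the latter is summable. *)
Lemma gaussian_mgf (phi : nat -> R -> R) (delta K C : R) :
    `|delta| <= 1 -> delta < 2^-1 -> 0 <= C -> 0 <= K ->
    (forall n l, (1 <= n)%N -> phi n l <= expR (K * n%:R * `|l|)) ->
    (forall n l, (1 <= n)%N ->
      phi n.+1 l <= expR (`|l| * (K / n%:R) + C * l ^+ 2) *
                    phi n (l * (1 + delta / n%:R))) ->
  exists (A B : R) (N : nat), 0 < A /\
    forall n l, (N <= n)%N -> phi n l <= expR (A * n%:R * l ^+ 2 + B).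
Proof.
move=> d1 d2 C0 K0 base rec.
have D : 0 < 1 - 2 * delta by lra.
pose N := (Num.truncn (2 / (1 - 2 * delta))).+1.
have NP : 2 / (1 - 2 * delta) < N%:R by exact: truncnS_gt.
pose A := 2 * (C + K ^+ 2 + 1) / (1 - 2 * delta).
have A0 : 0 < A by rewrite divr_gt0 //; move: (sqr_ge0 K); lra.
have N0 : 0 < N%:R :> R by rewrite ltr0n.
pose B := K ^+ 2 * N%:R / A + 1.
exists A, B, N; split => //.
(* the term [- n^-1] telescopes the summable errors [n ^- 2 / 2] *)
have main n : forall l, phi (N + n)%N l <=
    expR (A * (N + n)%:R * l ^+ 2 + B - (N + n)%:R^-1).
  elim: n => [|n IH] l.
    rewrite addn0; apply: (le_trans (base _ _ _)) => //; rewrite ler_expR.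
    have N1 : N%:R^-1 <= 1 :> R by rewrite invf_le1 // ler1n.
    suff : K * N%:R * `|l| <= A * N%:R * l ^+ 2 + K ^+ 2 * N%:R / A.
      by rewrite /B; lra.
    rewrite -[l ^+ 2]real_normK ?num_real //.
    have -> : A * N%:R * `|l| ^+ 2 + K ^+ 2 * N%:R / A = N%:R * (A * `|l| ^+ 2 + K ^+ 2 / A).
      by ring.
    have -> : K * N%:R * `|l| = N%:R * (K * `|l|) by ring.
    rewrite ler_pM2l // -subr_ge0.
    have -> : A * `|l| ^+ 2 + K ^+ 2 / A - K * `|l| =
        (A * `|l| - K / 2) ^+ 2 / A + 3 / 4 * K ^+ 2 / A.
      by field; rewrite gt_eqF.
    by rewrite addr_ge0 // divr_ge0 ?(ltW A0) ?sqr_ge0 // mulr_ge0 ?sqr_ge0 //; lra.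
  rewrite addnS; set k := (N + n)%N in IH *.
  have k1 : (1 <= k)%N by rewrite /k /N addSn.
  have k1R : 1 <= k%:R :> R by rewrite ler1n.
  have kR : 0 < k%:R :> R by lra.
  apply: (le_trans (rec _ _ k1)).
  apply: (le_trans (ler_wpM2l (expR_ge0 _) (IH _))).
  rewrite -expRD ler_expR -natr1.
  set x : R := k%:R in k1R kR *.
  set u := x^-1.
  have xu : x * u = 1 by rewrite divff // gt_eqF.
  have u0 : 0 < u by rewrite invr_gt0.
  have u1 : u <= 1 by rewrite invf_le1.
  have lin : `|l| * (K * u) <= K ^+ 2 * l ^+ 2 / 2 + u ^+ 2 / 2.
    have := sqr_ge0 (K * `|l| - u); have := real_normK (num_real l); nra.
  have tel : u ^+ 2 / 2 <= u - (x + 1)^-1.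
    have -> : u - (x + 1)^-1 = u * (x + 1)^-1.
      by rewrite /u; field; rewrite !gt_eqF //; lra.
    rewrite expr2 -mulrA ler_pM2l // /u -invfM lef_pV2 ?posrE //; lra.
  have Nu : 2 * u <= 1 - 2 * delta.
    have : 2 / (1 - 2 * delta) < x.
      by apply: (lt_le_trans NP); rewrite ler_nat leq_addr.
    rewrite ltr_pdivrMr // => h; have : u * 2 <= u * (x * (1 - 2 * delta)).
      by rewrite ler_pM2l // ltW.
    by rewrite mulrA [u * x]mulrC xu; lra.
  (* half of the gap [1 - 2 * delta] absorbs the term [delta ^+ 2 / n], the other
     half the increments, by the choice of [A] *)
  have quad : A * x * (1 + delta * u) ^+ 2 + C + K ^+ 2 / 2 <= A * (x + 1).
    have -> : A * x * (1 + delta * u) ^+ 2 = A * (x + 2 * delta + delta ^+ 2 * u).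
      have -> : A * x * (1 + delta * u) ^+ 2 =
        A * (x + 2 * delta * (x * u) + delta ^+ 2 * u * (x * u)) by ring.
      by rewrite xu !mulr1.
    have AD : A * (1 - 2 * delta) = 2 * (C + K ^+ 2 + 1) by rewrite divfK // gt_eqF.
    have dd : delta ^+ 2 * u <= u.
      have d2' : delta ^+ 2 <= 1 by rewrite -real_normK ?num_real // exprn_ile1.
      by move: (ler_wpM2r (ltW u0) d2'); rewrite mul1r.
    have AdU : A * (delta ^+ 2 * u) <= A * ((1 - 2 * delta) / 2).
      by rewrite ler_pM2l //; lra.
    have := sqr_ge0 K; lra.
  have := ler_wpM2r (sqr_ge0 l) quad.
  have -> : A * x * (l * (1 + delta * u)) ^+ 2 =
      A * x * (1 + delta * u) ^+ 2 * l ^+ 2 by ring.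
  lra.
move=> n l Nn; have := main (n - N)%N l; rewrite subnKC // => h.
apply: (le_trans h); rewrite ler_expR gerBl invr_ge0; exact: ler0n.
Qed.

End exponential_moments.

(** * The law of a turn *)

Lemma sum_cst_seq (R : pzRingType) (I : Type) (r : seq I) (c : R) :
  \sum_(j <- r) c = (size r)%:R * c.
Proof. by rewrite big_const_seq count_predT iter_addr addr0 mulr_natl. Qed.

Section turn_law.
Context (R : realType) (d : nat) (p q : R).
Context (W : {fset 'rV[R]_d}) (v : 'rV[R]_d).
Hypothesis W_ge2 : (2 <= #|` W|)%N.

Let m1_gt0 : 0 < #|` W|%:R - 1 :> R.
Proof. by rewrite subr_gt0 ltr1n. Qed.

Lemma sum_fset_pointed (f : 'rV[R]_d -> R) u (a b : R) : u \in W ->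
  \sum_(w <- W) (if w == u then a else b) * f w =
  (a - b) * f u + b * \sum_(w <- W) f w.
Proof.
move=> uW; rewrite !(bigD1_seq u) //= ?fset_uniq // eqxx.
under eq_bigr => w /negPf -> do [].
by rewrite -mulr_sumr; ring.
Qed.

(** A turn is uniform except for a bias towards one value, so averaging [f]
    gives a multiple of the favoured value plus a multiple of the total of [f],
    which will vanish for centred steps. *)
Lemma sum_turn_prob (f : 'rV[R]_d -> R) : (v \in W) || (- v \in W) ->
  \sum_(w <- W) turn_prob p q W v w * f w =
  if v \in W then
    erw_alpha #|` W| p * f v + (1 - p) / (#|` W|%:R - 1) * \sum_(w <- W) f w
  else
    erw_beta #|` W| q * f (- v) + (1 - q) / (#|` W|%:R - 1) * \sum_(w <- W) f w.
Proof.
rewrite /turn_prob; case: ifP => [vW _|_ /= vW]; rewrite sum_fset_pointed //.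
- by rewrite /erw_alpha; congr (_ * _ + _); field; rewrite gt_eqF.
- by rewrite /erw_beta; congr (_ * _ + _); field; rewrite gt_eqF.
Qed.

Lemma sum_turn_prob1 : (v \in W) || (- v \in W) ->
  \sum_(w <- W) turn_prob p q W v w = 1.
Proof.
move=> vW; under eq_bigr do rewrite -[turn_prob _ _ _ _ _]mulr1.
have W1 : \sum_(w <- W) (1 : R) = #|` W|%:R.
  by rewrite sum_cst_seq mulr1.
rewrite (sum_turn_prob (fun=> 1)) // W1 /erw_alpha /erw_beta.
by case: ifP => _; field; rewrite gt_eqF.
Qed.

Lemma turn_prob_ge0 w : 0 <= p <= 1 -> 0 <= q <= 1 -> 0 <= turn_prob p q W v w.
Proof.
move=> /andP[p0 p1] /andP[q0 q1]; rewrite /turn_prob.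
by case: ifP => _; case: ifP => _ //; apply: divr_ge0; rewrite ?subr_ge0 // -subr_ge0 ltW.
Qed.

End turn_law.

(** As [erw_beta] has the same formula as [erw_alpha], the bound serves for
    both. *)
Lemma erw_coeff_norm (R : realType) (m : nat) (p : R) :
  (2 <= m)%N -> 0 <= p <= 1 -> `|erw_alpha m p| <= 1.
Proof.
move=> m2 /andP[p0 p1].
have : 2 <= m%:R :> R by rewrite ler_nat.
rewrite /erw_alpha => m2'; rewrite ler_norml ler_pdivlMr ?ler_pdivrMr; try lra.
by apply/andP; split; nra.
Qed.

Section finite_law.
Context (R : realType) (d : nat) (Ve Vo : {fset 'rV[R]_d}) (p q : R).
Hypothesis VoE : Vo = [fset - v | v in Ve]%fset.
Hypothesis VoVe0 : (Vo `&` Ve)%fset = fset0.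
Hypothesis m_ge2 : (2 <= #|` Vo|)%N.
Hypotheses (p01 : 0 <= p <= 1) (q01 : 0 <= q <= 1).

Notation rV := 'rV[R]_d.
Notation m := #|` Vo|.
Notation steps := (steps Ve Vo).
Notation alpha := (erw_alpha m p).
Notation beta := (erw_beta m q).
Notation gamma := (erw_gamma m p q).
Notation delta := (erw_delta m p q).

Lemma mem_stepsN k j (v : rV) : odd k != odd j -> (- v \in steps k) = (v \in steps j).
Proof.
have oppVe (u : rV) : (- u \in Vo) = (u \in Ve).
  apply/idP/idP; rewrite VoE; last by move=> uV; apply/imfsetP; exists u.
  by move=> /imfsetP[x /= xV /oppr_inj ->].
rewrite /Defs.steps; case: (odd k); case: (odd j) => // _.
by rewrite -oppVe opprK.
Qed.

Lemma mem_steps_parity k j (v : rV) : v \in steps j ->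
  (v \in steps k) = (odd k == odd j).
Proof.
move=> vj; case: eqVneq => [e|ne]; first by rewrite /Defs.steps e in vj *.
apply/negbTE/negP => vk; suff : v \in (Vo `&` Ve)%fset by rewrite VoVe0 inE.
rewrite inE; move: vj vk ne; rewrite /Defs.steps.
by case: (odd k); case: (odd j) => //= -> ->.
Qed.

Lemma card_steps k : #|` steps k| = m.
Proof.
rewrite /Defs.steps; case: ifP => // _.
by rewrite VoE card_in_imfset //= => x y _ _ /oppr_inj.
Qed.

Lemma mem_steps_all k (v : rV) : v \in steps k -> v \in (Vo `|` Ve)%fset.
Proof. by rewrite inE /Defs.steps; case: ifP => _ ->; rewrite ?orbT. Qed.

(** ** Centred steps *)

Section coordinate.
Context (i : 'I_d).

Definition time_sign (k : nat) : R := (-1) ^+ k.+1.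
Definition mean_step : R := (\sum_(v <- Vo) v 0 i) / m%:R.
(** Centring by [mean_step] makes the steps of either parity sum to zero, since
    the two step sets are opposite. *)
Definition dev (k : nat) (v : rV) : R := v 0 i - time_sign k * mean_step.

Lemma time_signE k : time_sign k = if odd k then 1 else -1.
Proof. by rewrite /time_sign -signr_odd /=; case: (odd k); rewrite ?expr0 ?expr1. Qed.

Lemma time_sign_sqr k : time_sign k * time_sign k = 1.
Proof. by rewrite time_signE; case: ifP => _; rewrite ?mulr1 // mulrNN mulr1. Qed.

Lemma time_signS k : time_sign k.+1 = - time_sign k.
Proof. by rewrite /time_sign exprS mulN1r. Qed.

Lemma norm_time_sign k : `|time_sign k| = 1.
Proof. by rewrite /time_sign normrX normrN1 expr1n. Qed.

Lemma sum_dev k : \sum_(w <- steps k) dev k w = 0.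
Proof.
have m0 : m%:R != 0 :> R by rewrite pnatr_eq0 -lt0n (leq_trans _ m_ge2).
have constE (c : R) : \sum_(w <- steps k) c = m%:R * c.
  by rewrite sum_cst_seq -(card_steps k).
rewrite /dev big_split /= sumrN constE time_signE /Defs.steps /mean_step.
case: ifP => _; first by field.
rewrite {2}VoE big_imfset /=; last by move=> x y _ _ /oppr_inj.
under [\sum_(j <- Ve) (- j) 0 i]eq_bigr do rewrite mxE.
by rewrite sumrN; field.
Qed.

Lemma devN k j v : odd k != odd j -> dev k (- v) = - dev j v.
Proof.
rewrite /dev mxE !time_signE; case: (odd k); case: (odd j) => // _; ring.
Qed.

(** Remembering a step of the same parity contributes [alpha], one of the other
    parity [- beta]; these are [delta + gamma] and [delta - gamma]. *)
Lemma mean_turn k j v : v \in steps j ->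
  \sum_(w <- steps k) turn_prob p q (steps k) v w * dev k w =
  (delta + gamma * (time_sign k * time_sign j)) * dev j v.
Proof.
move=> vj; have vV : (v \in steps k) || (- v \in steps k).
  case: (eqVneq (odd k) (odd j)) => [e|ne]; first by rewrite (mem_steps_parity k vj) e eqxx.
  by rewrite (mem_stepsN v ne) vj orbT.
rewrite sum_turn_prob ?card_steps // sum_dev !mulr0 !addr0.
rewrite (mem_steps_parity k vj) /erw_delta /erw_gamma !time_signE.
case: eqVneq => [e|ne].
  have -> : dev k v = dev j v by rewrite /dev !time_signE e.
  by rewrite e; case: ifP => _; field.
by rewrite (devN v ne); move: ne; case: (odd k); case: (odd j) => // _; field.
Qed.

End coordinate.

(** ** Histories and their law *)

(** Histories list the steps from the most recent to the first, so that a new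
    step is consed on and the date of the head is the length of the list. *)
Fixpoint histories (n : nat) : seq (seq rV) :=
  if n is k.+1 then [seq w :: h | h <- histories k, w <- steps k.+1]
  else [:: [::]].

(** Conditional law of the step that follows [h]: the first step is uniform, a
    later one is a turn of a uniformly chosen earlier step. *)
Definition step_kernel (h : seq rV) (w : rV) : R :=
  if h is [::] then m%:R^-1
  else (size h)%:R^-1 * \sum_(v <- h) turn_prob p q (steps (size h).+1) v w.

Fixpoint history_prob (h : seq rV) : R :=
  if h is w :: h' then step_kernel h' w * history_prob h' else 1.

Lemma historiesSP n h : reflect
  (exists h' w, [/\ h = w :: h', h' \in histories n & w \in steps n.+1])
  (h \in histories n.+1).
Proof.
apply: (iffP allpairsPdep) => -[h' [w]].
  by move=> [h'n wn ->]; exists h', w.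
by move=> [-> h'n wn]; exists h', w.
Qed.

Lemma size_history n h : h \in histories n -> size h = n.
Proof.
elim: n h => [|n IH] h; first by rewrite inE => /eqP ->.
by case/historiesSP => h' [w [-> /IH /= -> _]].
Qed.

Lemma history_steps n h v : h \in histories n -> v \in h ->
  exists j, v \in steps j.
Proof.
elim: n h => [|n IH] h; first by rewrite inE => /eqP ->.
case/historiesSP => h' [w [-> /IH h'n wn]]; rewrite inE => /predU1P[->|/h'n].
  by exists n.+1.
exact.
Qed.

Lemma step_kernel_ge0 h w : 0 <= step_kernel h w.
Proof.
rewrite /step_kernel; case: h => [|v h]; first by rewrite invr_ge0 ler0n.
rewrite mulr_ge0 ?invr_ge0 ?ler0n // sumr_ge0 // => u _.
by rewrite turn_prob_ge0 ?card_steps.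
Qed.

Lemma history_prob_ge0 h : 0 <= history_prob h.
Proof. by elim: h => //= w h IH; rewrite mulr_ge0 // step_kernel_ge0. Qed.

Lemma sum_step_kernel_mul n h (f : rV -> R) : h \in histories n -> (0 < n)%N ->
  \sum_(w <- steps n.+1) step_kernel h w * f w =
  n%:R^-1 * \sum_(v <- h) \sum_(w <- steps n.+1) turn_prob p q (steps n.+1) v w * f w.
Proof.
move=> hn n0; have sh := size_history hn.
rewrite /step_kernel; case: h hn sh => [|u h] hn sh; first by rewrite -sh in n0.
rewrite sh exchange_big mulr_sumr /=; apply: eq_bigr => w _.
by rewrite -mulrA mulr_suml.
Qed.

Lemma sum_step_kernel n h : h \in histories n ->
  \sum_(w <- steps n.+1) step_kernel h w = 1.
Proof.
have [->|n0] := posnP n => hn.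
  move: hn; rewrite inE => /eqP ->; rewrite /= sum_cst_seq (card_steps 1).
  by rewrite divff // pnatr_eq0 -lt0n (leq_trans _ m_ge2).
under eq_bigr do rewrite -[step_kernel _ _]mulr1.
rewrite (sum_step_kernel_mul (fun=> 1)) //.
rewrite (_ : \sum_(v <- h) _ = \sum_(v <- h) 1); last first.
  rewrite big_seq [RHS]big_seq; apply: eq_bigr => v vh.
  under eq_bigr do rewrite mulr1.
  rewrite sum_turn_prob1 ?card_steps //.
  have [j vj] := history_steps hn vh.
  case: (eqVneq (odd n.+1) (odd j)) => [e|ne]; first by rewrite (mem_steps_parity _ vj) e eqxx.
  by rewrite (mem_stepsN v ne) vj orbT.
by rewrite sum_cst_seq (size_history hn) mulr1 mulVf // pnatr_eq0 -lt0n.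
Qed.

Lemma sum_histories_prob n : \sum_(h <- histories n) history_prob h = 1.
Proof.
elim: n => [|n IH]; first by rewrite big_seq1.
rewrite big_allpairs_dep /= -IH big_seq [RHS]big_seq.
apply: eq_bigr => h hn.
by rewrite -mulr_suml sum_step_kernel // mul1r.
Qed.

(** ** The corrected position *)

Section centred_walk.
Context (i : 'I_d).
Notation dev := (dev i).

Fixpoint centred_pos (h : seq rV) : R :=
  if h is w :: h' then centred_pos h' + dev (size h) w else 0.

Fixpoint signed_pos (h : seq rV) : R :=
  if h is w :: h' then signed_pos h' + time_sign (size h) * dev (size h) w else 0.

(** Since the signs alternate, the correction changes between consecutive dates
    by about [gamma * time_sign n.+1 * (signed_pos h / n%:R)], which is the
    non-decaying part of the drift. *)
Definition corrected_pos (h : seq rV) : R :=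
  centred_pos h - gamma / 2 * (time_sign (size h) * (signed_pos h / (size h)%:R)).

(** The conditional drift of the centred walk: averaging [mean_turn] over the
    remembered date produces the two sums along the history. *)
Lemma mean_next_step n h : h \in histories n -> (0 < n)%N ->
  \sum_(w <- steps n.+1) step_kernel h w * dev n.+1 w =
  delta / n%:R * centred_pos h +
  gamma * (time_sign n.+1 * (signed_pos h / n%:R)).
Proof.
move=> hn n0; rewrite (sum_step_kernel_mul _ hn) //.
have -> : \sum_(v <- h) \sum_(w <- steps n.+1)
    turn_prob p q (steps n.+1) v w * dev n.+1 w =
    delta * centred_pos h + gamma * time_sign n.+1 * signed_pos h.
  elim: (n) h hn n.+1 => [|n' IH] h; first by rewrite inE => /eqP -> k; rewrite big_nil /=; ring.
  case/historiesSP => h' [w [-> h'n wn]] k.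
  rewrite big_cons (IH _ h'n) (mean_turn _ _ wn) /= (size_history h'n).
  by ring.
by field; rewrite pnatr_eq0 -lt0n.
Qed.

Definition dev_bound : R :=
  \sum_(v <- (Vo `|` Ve)%fset) `|v 0 i| + `|mean_step i|.

Lemma dev_bound_ge0 : 0 <= dev_bound.
Proof. by rewrite addr_ge0 ?sumr_ge0. Qed.

Lemma dev_boundP k v : v \in steps k -> `|dev k v| <= dev_bound.
Proof.
move=> /mem_steps_all vV; apply: (le_trans (ler_normB _ _)).
rewrite normrM norm_time_sign mul1r lerD2r (bigD1_seq v) //= ?fset_uniq //.
by rewrite lerDl sumr_ge0.
Qed.

Lemma norm_pos n h : h \in histories n ->
  `|centred_pos h| <= n%:R * dev_bound /\ `|signed_pos h| <= n%:R * dev_bound.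
Proof.
elim: n h => [|n IH] h; first by rewrite inE => /eqP ->; rewrite normr0 mul0r.
case/historiesSP => h' [w [-> h'n wn]].
have [c s] := IH _ h'n; have b := dev_boundP wn.
rewrite /= (size_history h'n) -natr1 mulrDl mul1r.
split; apply: (le_trans (ler_normD _ _)); apply: lerD => //.
by rewrite normrM norm_time_sign mul1r.
Qed.

Lemma gamma_delta_norm : `|gamma| <= 1 /\ `|delta| <= 1.
Proof.
have : `|beta| <= 1 := erw_coeff_norm m_ge2 q01.
have := erw_coeff_norm m_ge2 p01.
rewrite /erw_gamma /erw_delta !ler_norml => /andP[? ?] /andP[? ?].
by split; apply/andP; split; lra.
Qed.

Lemma corrected_pos_near n h : h \in histories n ->
  `|centred_pos h - corrected_pos h| <= dev_bound.
Proof.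
move=> hn; rewrite /corrected_pos opprB addrC subrK (size_history hn).
have [g _] := gamma_delta_norm; have [_ s] := norm_pos hn.
have K0 := dev_bound_ge0.
move: g; generalize gamma => c g.
rewrite !normrM norm_time_sign mul1r.
have -> : `|2^-1| = 2^-1 :> R by rewrite ger0_norm.
have [->|n0] := posnP n; first by rewrite invr0 normr0 !mulr0.
have u : `|signed_pos h| * `|n%:R^-1| <= dev_bound.
  by rewrite ger0_norm ?invr_ge0 // ler_pdivrMr ?ltr0n // mulrC.
apply: (@le_trans _ _ (1 * dev_bound)); last by rewrite mul1r.
apply: ler_pM => //; rewrite ?mulr_ge0 //; move: g (normr_ge0 c); lra.
Qed.

(** The corrected position follows [1 + delta / n] times itself plus the centred
    innovation, up to an error of order [1 / n]: after cancellation of the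
    alternating term, each remaining term carries a factor [1 / n] times an
    average of the steps. *)
Lemma corrected_pos_step n h w : h \in histories n -> (0 < n)%N ->
    w \in steps n.+1 ->
  `|corrected_pos (w :: h) -
    ((1 + delta / n%:R) * corrected_pos h + dev n.+1 w -
     \sum_(u <- steps n.+1) step_kernel h u * dev n.+1 u)| <=
  2 * dev_bound / n%:R.
Proof.
move=> hn n0 wn; rewrite mean_next_step //.
rewrite /corrected_pos /= (size_history hn) time_signS.
have [g dl] := gamma_delta_norm; have [_ s] := norm_pos hn.
have K0 := dev_bound_ge0; have b := dev_boundP wn.
have nR : 0 < n%:R :> R by rewrite ltr0n.
have n1 : 0 < n.+1%:R :> R by rewrite ltr0n.
have e2 := time_sign_sqr n.
set e := time_sign n in e2 *.
set D := dev n.+1 w in b *; set T := signed_pos h in s *.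
set x : R := n%:R in s nR *; have xS : n.+1%:R = x + 1 by rewrite -natr1.
rewrite xS in n1 *.
set r := (X in `|X|).
have -> : r = x^-1 * (gamma / 2 * ((delta * (e * (T / x)) - e * (T / (x + 1)))
     - D * (x / (x + 1)))).
  transitivity (x^-1 * (gamma / 2 * ((delta * (e * (T / x)) - e * (T / (x + 1)))
     - (e * e) * D * (x / (x + 1))))); last by rewrite e2 mul1r.
  by rewrite /r; field; rewrite !gt_eqF.
have eT y : 0 < y -> x <= y -> `|e * (T / y)| <= dev_bound.
  move=> y0 xy; rewrite normrM norm_time_sign mul1r normrM (gtr0_norm (_ : 0 < y^-1)) ?invr_gt0 //.
  by rewrite ler_pdivrMr // (le_trans s) // mulrC ler_wpM2l.
have t1 : `|delta * (e * (T / x))| <= dev_bound.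
  by rewrite normrM -[leRHS]mul1r ler_pM // eT.
have t2 : `|e * (T / (x + 1))| <= dev_bound by rewrite eT //; lra.
have t3 : `|D * (x / (x + 1))| <= dev_bound.
  have xx0 : 0 <= x / (x + 1) by rewrite divr_ge0 // ltW.
  have xx1 : x / (x + 1) <= 1 by rewrite ler_pdivrMr //; lra.
  by rewrite normrM (ger0_norm xx0) -[leRHS]mulr1 ler_pM.
rewrite normrM gtr0_norm ?invr_gt0 // [leRHS]mulrC ler_pM2l ?invr_gt0 //.
rewrite normrM; apply: (@le_trans _ _ (2^-1 * (3 * dev_bound))); last lra.
apply: ler_pM => //.
  rewrite normrM (ger0_norm (_ : 0 <= 2^-1)) //; lra.
apply: (le_trans (ler_normB _ _)).
by have := ler_normB (delta * (e * (T / x))) (e * (T / (x + 1))); lra.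
Qed.

Definition mgf (n : nat) (l : R) : R :=
  \sum_(h <- histories n) history_prob h * expR (l * corrected_pos h).

Lemma mgf_step n l : (0 < n)%N ->
  mgf n.+1 l <= expR (`|l| * (2 * dev_bound / n%:R) + 8 * dev_bound ^+ 2 * l ^+ 2) *
                mgf n (l * (1 + delta / n%:R)).
Proof.
move=> n0; rewrite /mgf big_allpairs_dep /= mulr_sumr.
rewrite big_seq [leRHS]big_seq; apply: ler_sum => h hn.
set mu := \sum_(u <- steps n.+1) step_kernel h u * dev n.+1 u.
set E := expR (l * (1 + delta / n%:R) * corrected_pos h - l * mu +
               `|l| * (2 * dev_bound / n%:R)).
have H : \sum_(w <- steps n.+1) step_kernel h w * expR (l * dev n.+1 w) <=
    expR (l * mu + 8 * dev_bound ^+ 2 * l ^+ 2).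
  apply: hoeffding_mgf; [by move=> *; exact: step_kernel_ge0 | exact: sum_step_kernel |].
  by move=> w; exact: dev_boundP.
apply: (@le_trans _ _ (history_prob h * (E *
    \sum_(w <- steps n.+1) step_kernel h w * expR (l * dev n.+1 w)))).
  rewrite mulrA mulr_sumr big_seq [leRHS]big_seq; apply: ler_sum => w wn.
  rewrite [step_kernel h w * _]mulrC -!mulrA ler_wpM2l ?history_prob_ge0 //.
  rewrite mulrCA ler_wpM2l ?step_kernel_ge0 // -expRD ler_expR.
  have := corrected_pos_step hn n0 wn; rewrite -/mu.
  set r := (X in `|X| <= _) => rb.
  have lr : l * r <= `|l| * (2 * dev_bound / n%:R).
    by rewrite (le_trans (ler_norm _)) // normrM ler_wpM2l.
  have -> : corrected_pos (w :: h) =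
    (1 + delta / n%:R) * corrected_pos h + dev n.+1 w - mu + r by rewrite /r; ring.
  lra.
rewrite [leRHS]mulrCA ler_wpM2l ?history_prob_ge0 //.
apply: (le_trans (ler_wpM2l (expR_ge0 _) H)).
by rewrite -!expRD ler_expR; lra.
Qed.

Hypothesis delta_lt : delta < 2^-1.

Lemma mgf_gaussian : exists (A B : R) (N : nat), 0 < A /\
  forall n l, (N <= n)%N -> mgf n l <= expR (A * n%:R * l ^+ 2 + B).
Proof.
have K0 := dev_bound_ge0.
apply: (@gaussian_mgf _ _ delta (2 * dev_bound) (8 * dev_bound ^+ 2)) => //.
- by have [] := gamma_delta_norm.
- by rewrite mulr_ge0 ?sqr_ge0.
- lra.
- move=> n l n1; rewrite -[leRHS]mul1r -[X in _ <= X * _](sum_histories_prob n) mulr_suml.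
  rewrite /mgf big_seq [leRHS]big_seq; apply: ler_sum => h hn.
  rewrite ler_wpM2l ?history_prob_ge0 // ler_expR (le_trans (ler_norm _)) //.
  rewrite normrM mulrC ler_wpM2r //.
  have [c _] := norm_pos hn; have := corrected_pos_near hn.
  rewrite distrC => cn; have := ler_normD (corrected_pos h - centred_pos h) (centred_pos h).
  rewrite subrK => t.
  have : dev_bound <= n%:R * dev_bound by rewrite ler_peMl // ler1n.
  lra.
- by move=> n l n1; exact: mgf_step.
Qed.

(** Chernoff's inequality with the optimal parameter [x / (2 * A * n)], used on
    both signs. *)
Lemma corrected_pos_tail : exists (A B : R) (N : nat), 0 < A /\
  forall n (x : R), (N <= n)%N -> (0 < n)%N -> 0 <= x ->
  \sum_(h <- histories n | x <= `|corrected_pos h|) history_prob h <=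
  2 * expR (B - x ^+ 2 / (4 * A * n%:R)).
Proof.
have [A [B [N [A0 mgfP]]]] := mgf_gaussian.
exists A, B, N; split => // n x Nn n0 x0.
have nR : 0 < n%:R :> R by rewrite ltr0n.
pose l := x / (2 * A * n%:R).
have l0 : 0 <= l by rewrite divr_ge0 // !mulr_ge0 // ltW.
have tail (s : R) : s ^+ 2 = 1 ->
    expR (- l * x) * mgf n (s * l) <= expR (B - x ^+ 2 / (4 * A * n%:R)).
  move=> s2; apply: (le_trans (ler_wpM2l (expR_ge0 _) (mgfP _ _ Nn))).
  rewrite -expRD ler_expR exprMn s2 mul1r le_eqVlt; apply/orP; left; apply/eqP.
  by rewrite /l; field; rewrite !gt_eqF.
apply: (@le_trans _ _ (expR (- l * x) * mgf n (1 * l) + expR (- l * x) * mgf n (-1 * l))).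
  rewrite /mgf !mulr_sumr -big_split /= [leLHS]big_mkcond /=; apply: ler_sum => h _.
  rewrite [X in _ <= X + _]mulrCA [X in _ <= _ + X]mulrCA -mulrDr -!expRD.
  case: ifP => [xh|_]; last by rewrite mulr_ge0 ?history_prob_ge0 // addr_ge0 // expR_ge0.
  rewrite ler_peMr ?history_prob_ge0 //.
  have ge1 y : 0 <= y -> 1 <= expR y by rewrite -[X in X <= expR _]expR0 ler_expR.
  move: xh; rewrite ler_normr => /orP[] xh.
  - apply: (@le_trans _ _ (expR (- l * x + 1 * l * corrected_pos h))).
      by apply: ge1; nra.
    by rewrite lerDl expR_ge0.
  - apply: (@le_trans _ _ (expR (- l * x + -1 * l * corrected_pos h))).
      by apply: ge1; nra.
    by rewrite lerDr expR_ge0.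
have neg : (-1) ^+ 2 = 1 :> R by rewrite sqrrN expr1n.
have := tail 1 (expr1n _ _); have := tail _ neg.
set a := expR _ * _; set b := expR _ * _; set c := expR _ => ac bc.
by rewrite mulr_natl mulr2n addrC lerD.
Qed.

End centred_walk.

End finite_law.

(** * From the random walk to histories *)

Lemma measurable_set1_borel_rV (R : realType) (d : nat) (v : borel_rV R d) :
  measurable [set v].
Proof.
rewrite -[X in measurable X]setCK; apply: measurableC.
apply: sub_sigma_algebra; apply: closed_openC.
apply: (@accessible_closed_set1 'rV[R]_d).
exact: hausdorff_accessible (@norm_hausdorff R 'rV[R]_d).
Qed.

Lemma borel_cantelli_inv_sqr (R : realType) (dO : measure_display)
    (Omega : measurableType dO) (P : probability Omega R)
    (F : nat -> set Omega) (C : R) :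
    (forall k, measurable (F k)) ->
    (forall k, (P (F k) <= (C / k.+1%:R ^+ 2)%:E)%E) ->
  {ae P, forall omega, exists N, forall k, (N <= k)%N -> ~ F k omega}.
Proof.
move=> mF PF.
have C0 : 0 <= C.
  by have := le_trans (measure_ge0 P _) (PF 0%N); rewrite expr1n divr1 lee_fin.
(* telescoping: [1 / x ^+ 2 <= 2 / x - 2 / (x + 1)] for [1 <= x] *)
have sum_le n : \sum_(0 <= k < n) C / k.+1%:R ^+ 2 <= 2 * C * (1 - n.+1%:R^-1).
  elim: n => [|n IH]; first by rewrite big_geq // invr1 subrr mulr0.
  rewrite big_nat_recr //= (le_trans (lerD IH (lexx _))) //.
  have n1 : 1 <= n.+1%:R :> R by rewrite ler1n.
  have -> : n.+2%:R = n.+1%:R + 1 :> R by rewrite natr1.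
  move: n1; set x : R := n.+1%:R => x1.
  rewrite -subr_ge0.
  have -> : 2 * C * (1 - (x + 1)^-1) - (2 * C * (1 - x^-1) + C / x ^+ 2) =
    C * (x - 1) / (x ^+ 2 * (x + 1)) by field; rewrite !gt_eqF //; lra.
  by rewrite divr_ge0 ?mulr_ge0 ?sqr_ge0 //; lra.
have lim0 : P (lim_sup_set F) = 0%E.
  apply: lim_sup_set_cvg0 => //; apply: (@le_lt_trans _ _ (2 * C)%:E); last exact: ltry.
  apply: lime_le; first by apply: is_cvg_nneseries.
  apply: nearW => n; apply: (@le_trans _ _ (\sum_(0 <= k < n) (C / k.+1%:R ^+ 2)%:E)%E).
    by apply: lee_sum => k _; exact: PF.
  by rewrite sumEFin lee_fin (le_trans (sum_le n)) // ler_piMr ?mulr_ge0 // gerBl.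
exists (lim_sup_set F); split => //.
  by apply: bigcap_measurable => // k _; apply: bigcup_measurable.
move=> omega /= H n _ /=; apply: contrapT => nF; apply: H; exists n => k nk Fk.
by apply: nF; exists k.
Qed.

Section erw_history.
Context (R : realType) (d : nat) (Ve Vo : {fset 'rV[R]_d}) (p q : R).
Context (dO : measure_display) (Omega : measurableType dO).
Context (P : probability Omega R).
Context (X1 : {RV P >-> borel_rV R d}) (U : nat -> {RV P >-> nat}).
Context (G : nat -> 'rV[R]_d -> {RV P >-> borel_rV R d}).
Context (X S : nat -> Omega -> 'rV[R]_d).
Hypothesis model : erw_model Ve Vo p q X1 U G.
Hypothesis walk : erw_walk X1 U G X S.

Notation rV := 'rV[R]_d.
Notation steps := (steps Ve Vo).
Notation histories := (histories Ve Vo).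
Notation erw_field := (erw_field Ve Vo X1 U G).

Fixpoint history (n : nat) (omega : Omega) : seq rV :=
  if n is k.+1 then X n omega :: history k omega else [::].

Definition step_at (h : seq rV) (k : nat) : rV := nth 0 h (size h - k).

(** With the earlier steps frozen to [h'], the last step depends only on the
    variables of its own date; this is what makes the event lie in a single
    field of the independent family.  The condition [k < size h'] discards the
    dates at which [step_at] would return its default value. *)
Definition last_step_event (h : seq rV) : set Omega :=
  if h is w :: h' then
    if h' is [::] then X1 @^-1` [set w]
    else \bigcup_k ((U (size h') @^-1` [set k.+1] `&` [set _ | (k < size h')%N]) `&`
                    G (size h) (step_at h' k.+1) @^-1` [set w])
  else setT.

Lemma size_history_at n omega : size (history n omega) = n.
Proof. by elim: n => //= n ->. Qed.

Lemma step_at_history n omega k : (0 < k <= n)%N ->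
  step_at (history n omega) k = X k omega.
Proof.
rewrite /step_at size_history_at => /andP[k0 kn].
rewrite -(subnK kn); move: (n - k)%N => j; rewrite addnK.
elim: j => [|j IH] /=; first by case: k k0 {kn}.
exact: IH.
Qed.

Lemma last_step_eventP n h w omega : history n omega = h ->
  last_step_event (w :: h) omega <-> X n.+1 omega = w.
Proof.
move=> hE; have sh : size h = n by rewrite -hE size_history_at.
case: n hE sh => [|n] hE sh.
  by case: h hE sh => //= _ _; rewrite (step1 walk).
case: h hE sh => // u h hE [sh]; rewrite /last_step_event /= sh.
rewrite (stepS walk) //.
have /andP[U0 Un] := time_val model (ltn0Sn n) omega.
split.
  by move=> [k _ /= [[Uk kn] <-]]; rewrite -hE Uk (@step_at_history n.+1).
move=> <-; exists (U n.+1 omega).-1 => //=; rewrite prednK //; split => //.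
by rewrite -hE (@step_at_history n.+1) // U0.
Qed.

(** On the event that the history is [h], the frozen steps are the actual ones;
    this turns a condition on a recursively defined process into an intersection
    of conditions, one for each date. *)
Lemma history_event n h : size h = n ->
  [set omega | history n omega = h] =
  \bigcap_(j in `I_n) last_step_event (drop (n - j.+1) h).
Proof.
elim: n h => [|n IH] h.
  by move=> /size0nil ->; apply/seteqP; split.
case: h => // w h [sh]; apply/seteqP; split => omega /=.
  move=> [Xw hE] j /= jn; rewrite ltnS leq_eqVlt in jn.
  case/predU1P : jn => [->|jn]; first by rewrite subnn drop0; apply/(last_step_eventP _ hE).
  rewrite subSS -(subnSK jn) /=.
  have : [set omega | history n omega = h] omega by [].
  by rewrite IH //; apply.
move=> H; have hE : history n omega = h.
  suff : [set omega | history n omega = h] omega by [].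
  rewrite IH // => j /= jn; have := H j; rewrite /= ltnS (ltnW jn) => /(_ isT).
  by rewrite subSS -(subnSK jn).
have := H n; rewrite /= ltnSn subnn drop0 => /(_ isT) /(last_step_eventP _ hE) ->.
by rewrite hE.
Qed.

Lemma X_steps k omega : (0 < k)%N -> X k omega \in steps k.
Proof.
elim/ltn_ind: k => -[|[|k]] // IH _.
  by rewrite (step1 walk); exact: (first_val model).
rewrite (stepS walk) //; apply: (turn_val model) => //.
have /andP[U0 Un] := time_val model (ltn0Sn k) omega.
by apply: mem_steps_all (IH _ _ U0); rewrite ltnS.
Qed.

Lemma mem_history n omega : history n omega \in histories n.
Proof.
elim: n => [|n IH]; first by rewrite inE.
by apply/historiesSP; exists (history n omega), (X n.+1 omega); rewrite X_steps.
Qed.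

Lemma measurable_last_step_event h : measurable (last_step_event h).
Proof.
case: h => [|w [|v h]]; first exact: measurableT.
  by apply: measurable_funPTI; exact: measurable_set1_borel_rV.
apply: bigcup_measurable => k _; apply: measurableI; first apply: measurableI.
- exact: measurable_funPTI.
- case: (ltnP k (size (v :: h))) => ksz.
    by rewrite (_ : [set _ | _] = setT) //; apply/seteqP; split.
  by rewrite (_ : [set _ | _] = set0) //; apply/seteqP; split => // ? /=.
- by apply: measurable_funPTI; exact: measurable_set1_borel_rV.
Qed.

Lemma measurable_history_event n h : size h = n ->
  measurable [set omega | history n omega = h].
Proof.
move=> sh; rewrite history_event //; apply: bigcap_measurableType.
by move=> j _; exact: measurable_last_step_event.
Qed.

Lemma step_at_mem h k : (k < size h)%N -> step_at h k.+1 \in h.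
Proof. by move=> kh; rewrite mem_nth //; case: (size h) kh => // s _; rewrite ltn_subrL. Qed.

Lemma step_at_steps n h k : h \in histories n -> (k < n)%N ->
  step_at h k.+1 \in (Vo `|` Ve)%fset.
Proof.
move=> hn kn; have kh : (k < size h)%N by rewrite (size_history hn).
have [j vj] := history_steps hn (step_at_mem kh).
exact: mem_steps_all vj.
Qed.

Lemma preimage_field (d' : measure_display) (T' : measurableType d')
  (f : {RV P >-> T'}) (B : set T') : measurable B ->
  g_sigma_algebra_preimage f (f @^-1` B).
Proof. by move=> mB; exists B => //; rewrite setTI. Qed.

Lemma last_step_event_field n h w : h \in histories n ->
  erw_field n (last_step_event (w :: h)).
Proof.
move=> hn; have sh := size_history hn.
case: h hn sh => [|v h] hn sh.
  by rewrite -sh /Defs.erw_field /=; apply: preimage_field; exact: measurable_set1_borel_rV.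
rewrite /Defs.erw_field -sh /= -/(size (v :: h)).
apply: sigma_algebra_bigcup => k.
case: (ltnP k (size (v :: h))) => kn; last first.
  rewrite (_ : [set _ | _] = set0); last first.
    by apply/seteqP; split => // omega /=; rewrite ltnNge kn.
  by rewrite setI0 set0I; exact: sigma_algebra0.
rewrite (_ : [set _ | _] = setT) ?setIT; last by apply/seteqP; split.
set D := _ `|` _.
apply: (@measurableI _ (g_sigma_algebraType D)); apply: sub_sigma_algebra.
  by left; apply: preimage_field.
right; apply: sub_sigma_algebra.
exists (step_at (v :: h) k.+1); first by rewrite /= (step_at_steps hn) // -sh.
by apply: preimage_field; exact: measurable_set1_borel_rV.
Qed.

Lemma prob_bigcap_fields n (A : nat -> set Omega) :
  (forall j, (j < n)%N -> erw_field j (A j)) ->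
  P (\bigcap_(j in `I_n) A j) = (\prod_(j < n) P (A j))%E.
Proof.
move=> FA; have := erw_indep model (J := [fset j in iota 0 n]%fset) (A := A).
have memJ j : (j \in [fset j in iota 0 n]%fset) = (j < n)%N.
  by rewrite inE /= mem_iota add0n.
have -> : [set` [fset j in iota 0 n]%fset] = `I_n.
  by apply/seteqP; split => j /=; rewrite memJ.
move=> ->; last by move=> j; rewrite memJ; exact: FA.
rewrite -(big_mkord xpredT (fun j => P (A j))) /index_iota subn0.
apply: perm_big; apply: uniq_perm; rewrite ?fset_uniq ?iota_uniq // => j.
by rewrite memJ mem_iota add0n.
Qed.

(** The event splits according to the remembered date, which is uniform and
    independent of the turn. *)
Lemma prob_last_step n h w : h \in histories n -> w \in steps n.+1 ->
  P (last_step_event (w :: h)) = (step_kernel Ve Vo p q h w)%:E.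
Proof.
move=> hn wn; have sh := size_history hn.
case: h hn sh => [|v h] hn sh.
  by rewrite /= (first_law model) //; move: wn; rewrite -sh.
rewrite /last_step_event /step_kernel.
move: sh; set h1 := v :: h in hn * => sh; rewrite (_ : size (w :: h1) = n.+1) ?sh; last by rewrite -sh.
have n0 : (0 < n)%N by rewrite -sh.
pose F k := U n @^-1` [set k.+1] `&` G n.+1 (step_at h1 k.+1) @^-1` [set w].
rewrite (_ : \bigcup_k _ = \big[setU/set0]_(k < n) F k); last first.
  rewrite -bigcup_mkord; apply/seteqP; split => omega /=.
    by move=> [k _ [[Uk kn] Gw]]; exists k.
  by move=> [k kn [Uk Gw]]; exists k.
have mF k : measurable (F k).
  apply: measurableI; apply: measurable_funPTI => //.
  exact: measurable_set1_borel_rV.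
rewrite measure_semi_additive_ord_I //; last 2 first.
- apply/trivIsetP => i j _ _ ij; apply/seteqP; split => // omega /= [[Ui _] [Uj _]].
  by move: Ui Uj ij => /= -> [->]; rewrite eqxx.
- by apply: bigsetU_measurable.
transitivity (\sum_(k < n) (n%:R^-1 *
    turn_prob p q (steps n.+1) (step_at h1 k.+1) w)%:E)%E.
  apply: eq_bigr => k _; rewrite /F.
  have vV := step_at_steps hn (ltn_ord k).
  apply: (etrans (time_turn_indep model n0 _ _)).
  - by apply: preimage_field.
  - apply: sub_sigma_algebra; exists (step_at h1 k.+1) => //.
    by apply: preimage_field; exact: measurable_set1_borel_rV.
  rewrite EFinM; congr (_ * _)%E; last exact: (turn_law model).
  by apply: (time_law model); rewrite //= ltn_ord.
rewrite sumEFin -mulr_sumr; congr (_ * _)%:E.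
rewrite -(big_mkord xpredT (fun k => turn_prob p q (steps n.+1) (step_at h1 k.+1) w)).
rewrite [RHS](big_nth 0) sh [RHS]big_nat_rev /= add0n big_nat [RHS]big_nat.
by apply: eq_bigr => k _; rewrite /step_at sh.
Qed.

Lemma drop_history n h j : h \in histories n -> (j <= n)%N ->
  drop (n - j) h \in histories j.
Proof.
elim: n h => [|n IH] h hn; first by rewrite leqn0 => /eqP ->; rewrite drop0.
rewrite leq_eqVlt => /predU1P[->|jn]; first by rewrite subnn drop0.
case/historiesSP : hn => h' [w [-> h'n _]].
by rewrite subSn //= IH.
Qed.

(** Along a fixed history every step event involves the variables of a single
    date, so that independence turns the probability into a product. *)
Lemma prob_history n h : h \in histories n ->
  P [set omega | history n omega = h] = (history_prob Ve Vo p q h)%:E.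
Proof.
move=> hn; rewrite history_event ?(size_history hn) //.
rewrite prob_bigcap_fields; last first.
  move=> j jn; have /historiesSP[h' [w [-> h'j _]]] := drop_history hn jn.
  exact: last_step_event_field.
elim: n h hn => [|n IH] h; first by rewrite inE => /eqP ->; rewrite big_ord0.
case/historiesSP => h' [w [-> h'n wn]].
rewrite big_ord_recr /= subnn drop0 (prob_last_step h'n wn) EFinM muleC.
congr (_ * _)%E; rewrite -(IH _ h'n); apply: eq_bigr => j _.
by rewrite subSS -(subnSK (ltn_ord j)).
Qed.

Lemma prob_history_in n (s : seq (seq rV)) : {subset s <= histories n} ->
  measurable [set omega | history n omega \in s] /\
  (P [set omega | history n omega \in s] <=
    (\sum_(h <- s) history_prob Ve Vo p q h)%:E)%E.
Proof.
elim: s => [|h s IH] sub.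
  rewrite big_nil (_ : [set _ | _] = set0); last by apply/seteqP; split.
  by rewrite measure0.
have hn : h \in histories n by rewrite sub // mem_head.
have [ms Ps] := IH (fun x xs => sub x (@mem_behead _ (h :: s) x xs)).
have mh := measurable_history_event (size_history hn).
have -> : [set omega | history n omega \in h :: s] =
    [set omega | history n omega = h] `|` [set omega | history n omega \in s].
  apply/seteqP; split => omega /=; rewrite inE; first by move=> /predU1P.
  by case=> [->|->]; rewrite ?eqxx ?orbT.
split; first exact: measurableU.
rewrite (le_trans (measureU2 _ mh ms)) // big_cons EFinD leeD //.
by rewrite le_eqVlt; apply/orP; left; apply/eqP; exact: prob_history.
Qed.

(** The stationary means have alternating signs, so they sum to zero or to a
    single one. *)
Lemma S_history i n omega :
  S n omega 0 i = centred_pos Vo i (history n omega) + (odd n)%:R * mean_step Vo i.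
Proof.
elim: n => [|n IH]; first by rewrite (walk0 walk) mxE /= mul0r addr0.
rewrite (walkS walk) mxE IH /= size_history_at /dev time_signE /=.
by case: (odd n) => /=; ring.
Qed.

End erw_history.

(** * The almost sure bound *)

Section almost_sure_bound.
Context (R : realType) (d : nat) (Se So : set 'rV[R]_d).
Context (Ve Vo : {fset 'rV[R]_d}) (p q : R).
Context (dO : measure_display) (Omega : measurableType dO).
Context (P : probability Omega R).
Context (X1 : {RV P >-> borel_rV R d}) (U : nat -> {RV P >-> nat}).
Context (G : nat -> 'rV[R]_d -> {RV P >-> borel_rV R d}).
Context (X S : nat -> Omega -> 'rV[R]_d).
Hypothesis steps_ok : bipartite_steps Se So Ve Vo.
Hypothesis m_ge2 : (2 <= #|` Vo|)%N.
Hypotheses (p01 : 0 <= p <= 1) (q01 : 0 <= q <= 1).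
Hypothesis model : erw_model Ve Vo p q X1 U G.
Hypothesis walk : erw_walk X1 U G X S.
Hypothesis delta_lt : erw_delta #|` Vo| p q < 2^-1.

Let VoE := step_opp steps_ok.
Let VoVe0 := step_disjoint steps_ok.

(** The threshold [x n] below is such that the tail bound at [x n] is
    [2 * expR B / n ^ 2], hence summable. *)
Lemma erw_coord_bound (i : 'I_d) : exists A K : R,
  {ae P, forall omega, exists N, forall n, (N <= n)%N ->
    `|S n omega 0 i| <= Num.sqrt (A * (n%:R * ln n%:R)) + K}.
Proof.
have [A [B [N [A0 tail]]]] :=
  corrected_pos_tail VoE VoVe0 m_ge2 p01 q01 i delta_lt.
exists (8 * A), (dev_bound Ve Vo i + `|mean_step Vo i|).
pose x n : R := Num.sqrt (8 * A * (n%:R * ln n%:R)).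
pose z := corrected_pos Vo p q i.
pose bad n := [seq h <- histories Ve Vo n | x n <= `|z h|].
have badP n : (N < n)%N ->
    measurable [set omega | history X n omega \in bad n] /\
    (P [set omega | history X n omega \in bad n] <= (2 * expR B / n%:R ^+ 2)%:E)%E.
  move=> Nn; have n0 : (0 < n)%N by apply: leq_trans Nn.
  have nR : 0 < n%:R :> R by rewrite ltr0n.
  have [mb Pb] := prob_history_in model walk
    (s := bad n) (fun h => (mem_subseq (filter_subseq _ _) (x := h))).
  split => //; apply: (le_trans Pb); rewrite lee_fin big_filter.
  have ln0 : 0 <= ln n%:R :> R by rewrite ln_ge0 // ler1n.
  apply: (le_trans (tail n (x n) (ltnW Nn) n0 (sqrtr_ge0 _))).
  rewrite -[leRHS]mulrA ler_wpM2l // expRD ler_wpM2l ?expR_ge0 //.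
  have A0w := ltW A0; rewrite sqr_sqrtr ?mulr_ge0 //.
  have -> : - (8 * A * (n%:R * ln n%:R) / (4 * A * n%:R)) = - (2%:R * ln n%:R) :> R.
    by field; rewrite !gt_eqF.
  by rewrite expRN expRM_natl lnK ?posrE.
have ev : {ae P, forall omega, exists M, forall k, (M <= k)%N ->
    ~ (history X (N + k.+1)%N omega \in bad (N + k.+1)%N)}.
  apply: (borel_cantelli_inv_sqr (C := 2 * expR B)
    (F := fun k => [set omega | history X (N + k.+1)%N omega \in bad (N + k.+1)%N])).
    by move=> k; have [] := badP (N + k.+1)%N; rewrite // addnS ltnS leq_addr.
  move=> k; have [|_ /le_trans] := badP (N + k.+1)%N; first by rewrite addnS ltnS leq_addr.
  apply; rewrite lee_fin ler_wpM2l ?mulr_ge0 ?expR_ge0 //.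
  by rewrite lef_pV2 ?posrE ?exprn_gt0 ?ltr0n ?addnS // ler_sqr ?nnegrE // ler_nat ltnS leq_addl.
apply: filterS ev => omega [M good]; exists (N + M.+1)%N => n NMn.
have hn := mem_history model walk n omega.
have zx : `|z (history X n omega)| < x n.
  rewrite ltNge; apply/negP => xz.
  apply: (good (n - N.+1)%N); first by lia.
  have -> : (N + (n - N.+1).+1)%N = n by lia.
  by rewrite mem_filter xz hn.
have near := corrected_pos_near m_ge2 p01 q01 i hn.
rewrite (S_history Vo walk).
set c := centred_pos _ _ _ in near *.
have e : `|(odd n)%:R * mean_step Vo i| <= `|mean_step Vo i|.
  by rewrite normrM ler_piMl // normr_nat; case: (odd n).
have t1 := ler_normD c ((odd n)%:R * mean_step Vo i).
have t2 := ler_normD (c - z (history X n omega)) (z (history X n omega)).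
rewrite subrK in t2; rewrite -/(x n); rewrite -/(z _) in near; lra.
Qed.

End almost_sure_bound.

(** Once [1 <= ln n], the additive constant [K] is absorbed by
    [Num.sqrt (n * ln n)], and the quotient is at most a constant over
    [Num.sqrt (ln n `^ eta)]. *)
Lemma little_o_sqrt_log (R : realType) (A K eta : R) (u : nat -> R) (N : nat) :
    0 < eta -> (forall n, (N <= n)%N ->
      `|u n| <= Num.sqrt (A * (n%:R * ln n%:R)) + K) ->
  little_o u (fun n => Num.sqrt (n%:R * ln n%:R `^ (1 + eta))).
Proof.
move=> eta0 uP; apply/cvgr0Pnorm_le => e e0.
pose C : R := Num.sqrt `|A| + `|K|.
have C0 : 0 <= C by rewrite addr_ge0 // sqrtr_ge0.
(* beyond [expR L0], the power [ln n `^ eta] exceeds [(C / e) ^+ 2] *)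
pose L0 : R := ((C / e) ^+ 2) `^ eta^-1 + 1.
pose M := (maxn N (Num.truncn (expR L0)).+1).
exists M => //= n /=; rewrite geq_max => /andP[Nn nM].
have ne : expR L0 <= n%:R.
  by apply: ltW; apply: lt_le_trans (truncnS_gt _) _; rewrite ler_nat.
have nR : 0 < n%:R :> R by rewrite (lt_le_trans (expR_gt0 _) ne).
have n1 : 1 <= n%:R :> R by rewrite ler1n -(ltr0n R).
have Ln : L0 <= ln n%:R by rewrite -ler_expR lnK ?posrE.
set L := ln n%:R in Ln *.
have L1 : 1 <= L by rewrite (le_trans _ Ln) // lerDr powR_ge0.
have L0' : 0 < L by lra.
have nL1 : 1 <= n%:R * L by rewrite mulr_ege1.
have eL : C <= e * Num.sqrt (L `^ eta).
  rewrite mulrC -ler_pdivrMr // -(ger0_norm (divr_ge0 C0 (ltW e0))) -sqrtr_sqr.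
  rewrite ler_wsqrtr //.
  have -> : (C / e) ^+ 2 = (((C / e) ^+ 2) `^ eta^-1) `^ eta.
    by rewrite -powRrM mulVf ?gt_eqF // powRr1 ?sqr_ge0.
  rewrite ge0_ler_powR ?nnegrE ?powR_ge0 ?ltW //.
  by apply: lt_le_trans Ln; rewrite /L0 ltrDl.
have bE : Num.sqrt (n%:R * L `^ (1 + eta)) = Num.sqrt (n%:R * L) * Num.sqrt (L `^ eta).
  rewrite powRD; last by rewrite (gt_eqF L0') implybT.
  by rewrite powRr1 ?ltW // mulrA sqrtrM // mulr_ge0 ?ltW.
have s1 : 1 <= Num.sqrt (n%:R * L) by rewrite -[X in X <= _]sqrtr1 ler_wsqrtr.
have sL : 0 < Num.sqrt (L `^ eta) by rewrite sqrtr_gt0 powR_gt0.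
rewrite bE normrM normfV [X in _ / X]ger0_norm ?mulr_ge0 ?sqrtr_ge0 //.
rewrite ler_pdivrMr ?mulr_gt0 //; last lra.
apply: (le_trans (uP n Nn)); rewrite -/L.
apply: (@le_trans _ _ (Num.sqrt (n%:R * L) * C)).
  rewrite /C mulrDr lerD //.
    rewrite [leRHS]mulrC -sqrtrM // ler_wsqrtr //.
    by rewrite ler_wpM2r ?ler_norm //; lra.
  by apply: (le_trans (ler_norm K)); rewrite ler_peMl.
rewrite [leRHS]mulrCA ler_wpM2l //; lra.
Qed.

Lemma euclid_norm_le_sum (R : realType) (d : nat) (x : 'rV[R]_d) :
  euclid_norm x <= \sum_(i < d) `|x 0 i|.
Proof.
rewrite /euclid_norm -[leRHS]ger0_norm ?sumr_ge0 // -sqrtr_sqr ler_wsqrtr //.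
elim: (index_enum _) => [|i s IH]; first by rewrite !big_nil expr0n.
rewrite !big_cons sqrrD real_normK ?num_real // -addrA lerD2l.
by rewrite (le_trans IH) // lerDr mulrn_wge0 // mulr_ge0 // sumr_ge0.
Qed.

Unset Implicit Arguments.
Set Strict Implicit.
Set Printing Implicit Defensive.

Theorem theorem2p14 (R : realType) (d : nat)
    (Se So : set 'rV[R]_d) (Ve Vo : {fset 'rV[R]_d}) (p q : R)
    (dO : measure_display) (Omega : measurableType dO)
    (P : probability Omega R)
    (X1 : {RV P >-> borel_rV R d}) (U : nat -> {RV P >-> nat})
    (G : nat -> 'rV[R]_d -> {RV P >-> borel_rV R d})
    (X S : nat -> Omega -> 'rV[R]_d)
    (d_ge1 : (1 <= d)%N)
    (steps_ok : bipartite_steps Se So Ve Vo)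
    (m_ge2 : (2 <= #|` Vo|)%N)
    (p01 : 0 <= p <= 1) (q01 : 0 <= q <= 1)
    (model : erw_model Ve Vo p q X1 U G)
    (walk : erw_walk X1 U G X S)
    (gamma_lt : erw_gamma #|` Vo| p q < 1)
    (delta_lt : erw_delta #|` Vo| p q < 2^-1)
    (eta : R) (eta_gt0 : 0 < eta) :
  {ae P, forall omega,
    little_o (fun n => euclid_norm (S n omega))
             (fun n => Num.sqrt (n%:R * ln n%:R `^ (1 + eta)))}.
Proof.
pose b n : R := Num.sqrt (n%:R * ln n%:R `^ (1 + eta)).
have coords : {ae P, forall omega, forall k (kd : (k < d)%N),
    little_o (fun n => `|S n omega 0 (Ordinal kd)|) b}.
  apply: ae_foralln => k; have /orP[kd|kd] : (k < d)%N || (d <= k)%N by case: (ltnP k d).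
  2: by apply: aeW => omega kd'; have := leq_trans kd' kd; rewrite ltnn.
  have [A [K bound]] := erw_coord_bound steps_ok m_ge2 p01 q01 model walk delta_lt (Ordinal kd).
  apply: filterS bound => omega [N SN] kd'.
  apply: (little_o_sqrt_log eta_gt0 (A := A) (K := K) (N := N)) => n Nn.
  by rewrite normr_id (_ : Ordinal kd' = Ordinal kd); [exact: SN | exact: val_inj].
apply: filterS coords => omega small.
have sum0 : (fun n => \sum_(i < d) (`|S n omega 0 i| / b n)) @ \oo --> (0 : R).
  elim: (index_enum 'I_d) => [|i s IH].
    by under eq_fun do rewrite big_nil; exact: cvg_cst.
  under eq_fun do rewrite big_cons; rewrite -[X in nbhs X](addr0 (0 : R)); apply: cvgD IH.
  have := small i (ltn_ord i).
  by rewrite /little_o (_ : Ordinal _ = i) //; apply: val_inj.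
apply: (squeeze_cvgr _ (cvg_cst 0) sum0).
apply: nearW => n; rewrite divr_ge0 ?sqrtr_ge0 //= -mulr_suml ler_wpM2r ?invr_ge0 ?sqrtr_ge0 //.
exact: euclid_norm_le_sum.
Qed.
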